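(* Let $n\ge 1$ and let $\mathcal{G}_n$ be the set of canonical generators: a set consisting of exactly one representative $f$ of each SD class that contains a linear threshold function on $n$ variables, each representative being a positive, self-dual linear threshold function on $n+1$ variables $x_0,\dots,x_n$ whose Chow parameters have the form $(2^n,2a_0,\dots,2a_n)$ with $\mathbf{a}=(a_0,\dots,a_n)$ in monotonic order. Then $$\sum_{f\in\mathcal{G}_n}\mathrm{SGoldSD}(f,\mathbf{a})$$ is the total number of Semi-Goldilocks functions on $n$ variables, and $$\sum_{f\in\mathcal{G}_n}\mathrm{GoldSD}(f,\mathbf{a})$$ is the total number of Goldilocks functions on $n$ variables.
   Context: A linear threshold function (LTF) on $n$ variables is a function $f:\{0,1\}^n\to\{0,1\}$ of the form $f(\mathbf{x})=\operatorname{sgn}(\mathbf{w}\cdot\mathbf{x}-\theta)$ with $\mathbf{w}\in\mathbb{Q}^n$, $\theta\in\mathbb{Q}$, where $\operatorname{sgn}(t)=1$ for $t>0$ and $0$ for $t\le 0$; $(\mathbf{w},\theta)$ is a realization of $f$. An LTF is positive if it has a realization with all $w_i>0$; small if it has a realization with $w_i\le\theta$ for all $i$ (equivalently $f(\hat e_i)=0$ for every standard basis vector $\hat e_i$); ample if it has a realization with $\sum_i w_i>2\theta$. Semi-Goldilocks means positive and small; Goldilocks means positive, small and ample. The dual of $f$ is $f^d(\mathbf{x})=\overline{f(\overline{\mathbf{x}})}$, where the bar denotes (componentwise) negation; $f$ is self-dual if $f=f^d$. The self-dualization of a boolean function $f$ on $n$ variables is the function $f^{sd}$ on $n+1$ variables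 with $f^{sd}(0,x_1,\dots,x_n)=f(x_1,\dots,x_n)$ and $f^{sd}(1,x_1,\dots,x_n)=f^d(x_1,\dots,x_n)$. The anti-self-dualization of a self-dual function $\mathscr F$ on $n+1$ variables is $\mathscr F(0,x_1,\dots,x_n)$. Two boolean functions are in the same SD class if one can be transformed into the other by a sequence of permutations of variables, negations of variables, self-dualizations and anti-self-dualizations. For a function $f$ on $N$ variables with true set $T=f^{-1}(1)$ and false set $F=f^{-1}(0)$, the Chow parameters are $(m,\mathbf{b})$ with $m=|T|$ and $\mathbf{b}=\sum_{\mathbf{x}\in T}\mathbf{x}+\sum_{\mathbf{x}\in F}\overline{\mathbf{x}}\in\mathbb{N}^N$. For $f$ on $n+1$ variables $x_0,\dots,x_n$, $i\in\{0,\dots,n\}$ and $s\in\{0,1\}$, $f_{x_i=s}$ is the function on the remaining $n$ variables (kept in order) obtained by setting $x_i=s$. Let $\mathrm{PermCount}(f,i,s,\mathbf{a})$ be the size of the orbit of $f_{x_i=s}$ under the action of $S_n$ permuting its $n$ arguments. $\mathrm{SGoldSD}(f,\mathbf{a})$: start with $s=0$. For $i=0,1,\dots,n$: if $i=0$ or $a_i\ne a_{i-1}$, then (1) if $f_{x_i=1}$ is small, add $\mathrm{PermCount}(f,i,1,\mathbf{a})$ to $s$; (2) if $f_{x_i=0}$ is small and $a_i\neq 2^{n-1}$, add $\mathrm{PermCount}(f,i,0,\mathbf{a})$ to $s$. Return $s$. $\mathrm{GoldSD}(f,\mathbf{a})$: start with $s=0$. For $i=0,1,\dots,n$: if $i=0$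 or $a_i\neq a_{i-1}$, set $\mathrm{val}=1$ if $a_i>2^{n-1}$ and $\mathrm{val}=0$ otherwise; if $f_{x_i=\mathrm{val}}$ is small, add $\mathrm{PermCount}(f,i,\mathrm{val},\mathbf{a})$ to $s$. Return $s$. *)

(* Defs.v *)
From mathcomp Require Import all_boot all_order all_algebra.
From mathcomp Require Import perm boolp.

Set Implicit Arguments.
Unset Strict Implicit.
Unset Printing Implicit Defensive.

Import Order.TTheory GRing.Theory Num.Theory.

Notation bvec n := {ffun 'I_n -> bool}.
Notation bfun n := {ffun bvec n -> bool}.


Definition bcompl n (x : bvec n) : bvec n := [ffun i => ~~ x i].

Section Threshold.
Local Open Scope ring_scope.

Definition sgn (t : rat) : bool := 0 < t.

Definition dot n (w : 'I_n -> rat) (x : bvec n) : rat :=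
  \sum_(i < n) w i * (x i)%:R.

Definition realization n (f : bfun n) (w : 'I_n -> rat) (theta : rat) : Prop :=
  forall x : bvec n, f x = sgn (dot w x - theta).

Definition ltf n (f : bfun n) : Prop :=
  exists w theta, realization f w theta.

Definition positive n (f : bfun n) : Prop :=
  exists w theta, realization f w theta /\ forall i, 0 < w i.

Definition small n (f : bfun n) : Prop :=
  exists w theta, realization f w theta /\ forall i, w i <= theta.

Definition ample n (f : bfun n) : Prop :=
  exists w theta, realization f w theta /\ \sum_(i < n) w i > 2 * theta.

(* The realizations witnessing the three properties need not coincide. *)
Definition semi_goldilocks n (f : bfun n) : Prop := positive f /\ small f.

Definition goldilocks n (f : bfun n) : Prop :=
  [/\ positive f, small f & ample f].

End Threshold.

Definition dual n (f : bfun n) : bfun n := [ffun x => ~~ f (bcompl x)].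

Definition self_dual n (f : bfun n) : Prop := f = dual f.

Definition btail n (x : bvec n.+1) : bvec n := [ffun j => x (lift ord0 j)].

(* The point of {0,1}^(n+1) with s at coordinate i and the coordinates of y,
   in order, elsewhere. *)
Definition binsert n (i : 'I_n.+1) (s : bool) (y : bvec n) : bvec n.+1 :=
  [ffun k => if unlift i k is Some j then y j else s].

(* f_{x_i = s} *)
Definition restrict n (f : bfun n.+1) (i : 'I_n.+1) (s : bool) : bfun n :=
  [ffun y => f (binsert i s y)].

Definition self_dualization n (f : bfun n) : bfun n.+1 :=
  [ffun x : bvec n.+1 =>
     if x ord0 then dual f (btail x) else f (btail x)].

Definition anti_self_dualization n (f : bfun n.+1) : bfun n :=
  restrict f ord0 false.

Definition perm_vars n (p : 'S_n) (f : bfun n) : bfun n :=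
  [ffun x : bvec n => f [ffun i => x (p i)]].

Definition neg_var n (i : 'I_n) (f : bfun n) : bfun n :=
  [ffun x : bvec n => f [ffun j => if j == i then ~~ x j else x j]].

(* An SD class contains functions of different arities. Every step can be
   undone by further steps, so this relation is symmetric. *)
Inductive same_sd_class n (f : bfun n) : forall m, bfun m -> Prop :=
| SDrefl : same_sd_class f f
| SDperm m (g : bfun m) (p : 'S_m) :
    same_sd_class f g -> same_sd_class f (perm_vars p g)
| SDneg m (g : bfun m) (i : 'I_m) :
    same_sd_class f g -> same_sd_class f (neg_var i g)
| SDself_dualization m (g : bfun m) :
    same_sd_class f g -> same_sd_class f (self_dualization g)
| SDanti_self_dualization m (g : bfun m.+1) :
    self_dual g -> same_sd_class f g ->
    same_sd_class f (anti_self_dualization g).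

Definition true_set n (f : bfun n) : {set bvec n} := [set x | f x].
Definition false_set n (f : bfun n) : {set bvec n} := [set x | ~~ f x].

Definition chow n (f : bfun n) : nat * {ffun 'I_n -> nat} :=
  (#|true_set f|,
   [ffun i => \sum_(x in true_set f) nat_of_bool (x i) +
              \sum_(x in false_set f) nat_of_bool (bcompl x i)]).

Definition monotonic n (a : 'I_n -> nat) : Prop :=
  (forall i j : 'I_n, i <= j -> a i <= a j) \/
  (forall i j : 'I_n, i <= j -> a j <= a i).

Definition canonical_generator n (f : bfun n.+1) (a : {ffun 'I_n.+1 -> nat})
    : Prop :=
  [/\ positive f, self_dual f, chow f = (2 ^ n, [ffun i => 2 * a i])
    & monotonic a].

(* a f is the vector a attached to the generator f; it is irrelevant outside
   of G. *)
Definition canonical_generators n (G : {set bfun n.+1})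
    (a : bfun n.+1 -> {ffun 'I_n.+1 -> nat}) : Prop :=
  [/\ forall f, f \in G -> canonical_generator f (a f),
      forall f, f \in G -> exists g : bfun n, ltf g /\ same_sd_class g f
    & forall g : bfun n, ltf g ->
        exists! f : bfun n.+1, f \in G /\ same_sd_class g f].

Definition PermCount n (f : bfun n.+1) (i : 'I_n.+1) (s : bool) : nat :=
  #|[set perm_vars p (restrict f i s) | p : 'S_n]|.

(* i = 0 or a_i <> a_(i-1) *)
Definition new_value n (a : {ffun 'I_n.+1 -> nat}) (i : 'I_n.+1) : bool :=
  (i == ord0) || (a i != a (inord i.-1)).

Definition SGoldSD n (f : bfun n.+1) (a : {ffun 'I_n.+1 -> nat}) : nat :=
  \sum_(i < n.+1 | new_value a i)
    ((if `[< small (restrict f i true) >] then PermCount f i true else 0) +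
     (if `[< small (restrict f i false) >] && (a i != 2 ^ n.-1)
      then PermCount f i false else 0)).

Definition GoldSD n (f : bfun n.+1) (a : {ffun 'I_n.+1 -> nat}) : nat :=
  \sum_(i < n.+1 | new_value a i)
    (let val := 2 ^ n.-1 < a i in
     if `[< small (restrict f i val) >] then PermCount f i val else 0).

(* Main.v *)
Require Import Defs.
From mathcomp Require Import all_boot all_order all_algebra.
From mathcomp Require Import perm boolp.
From mathcomp Require Import zify lra.

(** Up to dummy variables, permutations and negations of variables, the
self-dualization of [g] is an invariant of the SD class of [g]. Hence a positive
[g] in the class of a generator [f] is, up to a permutation of variables, a
restriction [f_{x_i=s}]: both functions being monotone, the negations can be
dropped. Since [f] is self-dual and positive, [f_{x_i=1}] has [a_i >= 2^(n-1)]
true points and [f_{x_i=0}] has [2^n - a_i]. So restrictions with different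
[a_i] lie in different orbits, and so do the two restrictions at [i] unless
[a_i = 2^(n-1)], when [f] does not depend on [x_i] and they coincide.
Conversely, [a_i = a_j] makes a threshold function symmetric in [x_i] and [x_j],
so one index per value of [a] suffices. Finally an ample function is true on at
least half of the points, and [f_{x_i=1}] is always ample, which singles out the
restriction counted by [GoldSD]. *)

Set Implicit Arguments.
Unset Strict Implicit.
Unset Printing Implicit Defensive.

Import Order.TTheory GRing.Theory Num.Theory.

(** * Double counting and extending permutations *)

(** After exchanging the two sums, each point of [B] contributes exactly 1. *)
Lemma card_unique_cover (I T : finType) (P : pred I) (A : I -> {set T})
    (B : {set T}) :
  (forall i, P i -> A i \subset B) ->
  (forall x, x \in B -> exists! i, P i /\ x \in A i) ->
  \sum_(i | P i) #|A i| = #|B|.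
Proof.
move=> sub_AB uniqA.
rewrite -sum1_card (eq_bigr (fun i => \sum_(x in B) (x \in A i))); last first.
  move=> i Pi; rewrite -sum1_card -big_mkcondr /=.
  apply: eq_bigl => x; case xA: (x \in A i); rewrite ?andbF //.
  by rewrite (subsetP (sub_AB i Pi)).
rewrite exchange_big; apply: eq_bigr => x xB.
have [i [[Pi xAi] uniq_i]] := uniqA x xB.
rewrite (bigD1 i) //= xAi big1 // => j /andP[Pj]; apply: contraNeq.
by rewrite eqb0 negbK => xAj; apply/eqP/esym/uniq_i.
Qed.

(* A permutation agreeing with [v] at as many places as possible works: at a
   missed place, composing with a transposition would gain one. *)
Lemma extend_perm N (v : 'I_N -> nat) : injective v ->
  exists s : 'S_N, forall k, v k < N -> s k = v k :> nat.
Proof.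
move=> v_inj.
pose agree (s : 'S_N) := #|[set k | s k == v k :> nat]|.
have [s _ s_max] := @arg_maxnP {perm 'I_N} 1%g xpredT agree isT.
exists s => k vk; apply/eqP; apply: contraT => sk.
pose s' := (s * tperm (s k) (Ordinal vk))%g.
have : agree s' <= agree s := s_max s' isT; rewrite leqNgt => /negP[].
apply: proper_card; apply/properP; split.
  apply/subsetP=> l; rewrite !inE => /eqP sl; rewrite permM tpermD ?sl //.
    by apply: contraNneq sk => /perm_inj ->; apply/eqP.
  by apply: contraNneq sk => /(congr1 val) /=; rewrite sl => /v_inj ->; apply/eqP.
by exists k; rewrite !inE // permM tpermL /=.
Qed.

Lemma lift_perm_ex n (i j : 'I_n.+1) (s : 'S_n.+1) :
  s i = j -> exists p : 'S_n, s = lift_perm i j p.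
Proof.
(* The default of [odflt] is never reached: [s] already sends [i] to [j], so by injectivity
   [s (lift i k)] differs from [j]. *)
move=> sij; pose p0 k := odflt k (unlift j (s (lift i k))).
have p0E k : lift j (p0 k) = s (lift i k).
  rewrite /p0; case: unliftP => [l -> //|]; rewrite -sij => /perm_inj /eqP.
  by rewrite eq_sym (negPf (neq_lift _ _)).
have p0_inj : injective p0.
  by move=> k l /(congr1 (lift j)); rewrite !p0E => /perm_inj /lift_inj.
exists (perm p0_inj); apply/permP => k.
case: (unliftP i k) => [l|] ->; first by rewrite lift_perm_lift permE p0E.
by rewrite lift_perm_id.
Qed.

(** * Permuting, complementing and inserting coordinates *)

Lemma bcomplK n : involutive (@bcompl n).
Proof. by move=> x; apply/ffunP => i; rewrite !ffunE negbK. Qed.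

Lemma perm_vars1 n (g : bfun n) : perm_vars 1 g = g.
Proof.
apply/ffunP => x; rewrite ffunE; congr (g _).
by apply/ffunP => i; rewrite ffunE perm1.
Qed.

Lemma perm_varsM n (p q : 'S_n) (g : bfun n) :
  perm_vars p (perm_vars q g) = perm_vars (q * p)%g g.
Proof.
apply/ffunP => x; rewrite !ffunE; congr (g _).
by apply/ffunP => i; rewrite !ffunE permM.
Qed.

Lemma perm_varsK n (p : 'S_n) : cancel (@perm_vars n p) (@perm_vars n p^-1).
Proof. by move=> g; rewrite perm_varsM mulgV perm_vars1. Qed.

Lemma bcompl_binsert n (i : 'I_n.+1) s (y : bvec n) :
  bcompl (binsert i s y) = binsert i (~~ s) (bcompl y).
Proof.
by apply/ffunP => k; rewrite !ffunE; case: unliftP => // j _; rewrite ffunE.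
Qed.

Lemma binsert_id n (i : 'I_n.+1) s (y : bvec n) : binsert i s y i = s.
Proof. by rewrite ffunE unlift_none. Qed.

Lemma binsert_lift n (i : 'I_n.+1) s (y : bvec n) k :
  binsert i s y (lift i k) = y k.
Proof. by rewrite ffunE liftK. Qed.

Lemma binsertK n (i : 'I_n.+1) (x : bvec n.+1) :
  binsert i (x i) [ffun k => x (lift i k)] = x.
Proof.
by apply/ffunP => k; rewrite ffunE; case: unliftP => [j|] -> //; rewrite ffunE.
Qed.

Lemma binsert_perm n (i j : 'I_n.+1) (p : 'S_n) s (y : bvec n) :
  [ffun k => binsert i s y (lift_perm j i p k)]
  = binsert j s [ffun k => y (p k)].
Proof.
apply/ffunP => k; rewrite ffunE; case: (unliftP j k) => [l|] ->.
  by rewrite lift_perm_lift !binsert_lift ffunE.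
by rewrite lift_perm_id !binsert_id.
Qed.

Lemma btail_binsert n s (y : bvec n) : btail (binsert ord0 s y) = y.
Proof. by apply/ffunP => k; rewrite ffunE binsert_lift. Qed.

(** * Self-duality, self-dualization and the SD relation *)

Lemma self_dualE n (f : bfun n) x : self_dual f -> f (bcompl x) = ~~ f x.
Proof. by move=> {1}->; rewrite ffunE bcomplK. Qed.

Lemma restrict_self_dual n (f : bfun n.+1) i s y : self_dual f ->
  restrict f i (~~ s) (bcompl y) = ~~ restrict f i s y.
Proof. by move=> sdf; rewrite !ffunE -bcompl_binsert self_dualE. Qed.

Lemma self_dualization_self_dual n (f : bfun n) :
  self_dual (self_dualization f).
Proof.
apply/ffunP => x; rewrite !ffunE.
have -> : btail (bcompl x) = bcompl (btail x).
  by apply/ffunP => k; rewrite !ffunE.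
by case: (x ord0); rewrite ?bcomplK ?negbK.
Qed.

(** The two halves of the self-dualization coincide, so a self-dual function only gains a dummy
    variable. *)
Lemma self_dualization_of_self_dual n (f : bfun n) x :
  self_dual f -> self_dualization f x = f (btail x).
Proof. by move=> sdf; rewrite !ffunE self_dualE // negbK if_same. Qed.

Lemma self_dualizationK n (f : bfun n.+1) :
  self_dual f -> self_dualization (anti_self_dualization f) = f.
Proof.
move=> sdf; apply/ffunP => x; rewrite !ffunE -[RHS](congr1 f (binsertK ord0 x)).
have -> : btail x = [ffun k => x (lift ord0 k)] by [].
by case: (x ord0) => //; rewrite -self_dualE // bcompl_binsert bcomplK.
Qed.

Lemma self_dualizationE n (f : bfun n) s y :
  self_dualization f (binsert ord0 s y) = if s then dual f y else f y.
Proof. by rewrite ffunE binsert_id btail_binsert. Qed.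

Lemma self_dualization_perm n (p : 'S_n) (g : bfun n) :
  self_dualization (perm_vars p g) =
  perm_vars (lift_perm ord0 ord0 p) (self_dualization g).
Proof.
apply/ffunP => x; rewrite -(binsertK ord0 x) [RHS]ffunE binsert_perm.
rewrite !self_dualizationE !ffunE.
by case: (x ord0) => //; congr (~~ g _); apply/ffunP => k; rewrite !ffunE.
Qed.

Lemma self_dualization_neg n (i : 'I_n) (g : bfun n) :
  self_dualization (neg_var i g) =
  neg_var (lift ord0 i) (self_dualization g).
Proof.
apply/ffunP => x; rewrite -(binsertK ord0 x) [RHS]ffunE.
set z := [ffun k => x _].
have -> : [ffun j => if j == lift ord0 i then ~~ binsert ord0 (x ord0) z j
    else binsert ord0 (x ord0) z j] =
    binsert ord0 (x ord0) [ffun j => if j == i then ~~ z j else z j].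
  apply/ffunP => k; rewrite ffunE; case: (unliftP ord0 k) => [l|] ->.
    by rewrite !binsert_lift [RHS]ffunE (inj_eq lift_inj).
  by rewrite !binsert_id (negPf (neq_lift _ _)).
rewrite !self_dualizationE !ffunE.
case: (x ord0) => //; congr (~~ g _).
by apply/ffunP => k; rewrite !ffunE; case: eqP.
Qed.

(* The arity varies along a chain of SD steps, so the points of all functions
   involved are read off one sequence [x] indexed by [nat]. *)
Lemma same_sd_class_pull n (g : bfun n) m (h : bfun m) : same_sd_class g h ->
  exists (v : 'I_m.+1 -> nat) (c : 'I_m.+1 -> bool), injective v /\
    forall x : nat -> bool,
      self_dualization g [ffun k : 'I_n.+1 => x k] =
      self_dualization h [ffun k => x (v k) (+) c k].
Proof.
elim=> {m h} [|m h p _ [v [c [v_inj IH]]]|m h i _ [v [c [v_inj IH]]]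
    |m h _ [v [c [v_inj IH]]]|m h sdh _ [v [c [v_inj IH]]]].
- exists val, (fun=> false); split=> [|x]; first exact: val_inj.
  by congr (self_dualization g _); apply/ffunP => k; rewrite !ffunE addbF.
- pose q := (lift_perm ord0 ord0 p)^-1%g.
  exists (v \o q), (c \o q); split=> [|x]; first exact: inj_comp perm_inj.
  rewrite self_dualization_perm [RHS]ffunE IH; congr (self_dualization h _).
  by apply/ffunP => k; rewrite !ffunE /= permK.
- exists v, (fun k => c k (+) (k == lift ord0 i)); split=> // x.
  rewrite self_dualization_neg [RHS]ffunE IH; congr (self_dualization h _).
  apply/ffunP => k; rewrite !ffunE addbA.
  by case: eqP => _; rewrite ?addbT ?negbK ?addbF.
(* The added variable is a dummy one, since the function is already self-dual; any index outside the
   range of [v] can feed it while keeping injectivity. *)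
- pose fresh := (\max_k v k).+1.
  have v_fresh k : v k != fresh.
    by rewrite neq_ltn ltnS leq_bigmax.
  exists (fun k => if unlift ord0 k is Some j then v j else fresh),
         (fun k => if unlift ord0 k is Some j then c j else false).
  split=> [k l|x].
    case: (unliftP ord0 k) => [k'|] ->; case: (unliftP ord0 l) => [l'|] -> //.
    - by move=> /v_inj ->.
    - by move=> /eqP; rewrite (negPf (v_fresh _)).
    - by move=> /eqP; rewrite eq_sym (negPf (v_fresh _)).
  rewrite (self_dualization_of_self_dual _ (self_dualization_self_dual h)) IH.
  by congr (self_dualization h _); apply/ffunP => k; rewrite !ffunE liftK.
(* Self-dualizing again gives [h] back, whereas [self_dualization h] carries a dummy variable 0,
   whose index is dropped. *)
- exists (v \o lift ord0), (c \o lift ord0).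
  split=> [|x]; first exact: inj_comp v_inj (@lift_inj _ _).
  rewrite (self_dualizationK sdh) IH (self_dualization_of_self_dual _ sdh).
  by congr (h _); apply/ffunP => k; rewrite !ffunE.
Qed.

(** The reindexing [v] may leave the range [0..n], but the self-dualization of [g] reads nothing
    there, so [f] does not depend on those variables. Any permutation agreeing with [v] inside the
    range then serves. *)
Lemma same_sd_class_perm_neg n (g : bfun n) (f : bfun n.+1) :
  self_dual f -> same_sd_class g f ->
  exists (s : 'S_n.+1) (c : 'I_n.+1 -> bool), forall x,
    self_dualization g x = f [ffun k => x (s k) (+) c k].
Proof.
move=> sdf /same_sd_class_pull [v0 [c0 [v0_inj pull]]].
pose v := v0 \o lift ord0; have v_inj : injective v := inj_comp v0_inj lift_inj.
have [s sE] := extend_perm v_inj.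
exists s, (c0 \o lift ord0) => z.
(* Out of range the values of [x] are free: at [v k] the one [s] would read is chosen. The final
   [false] concerns indices that are never read. *)
pose x j := if insub j is Some i then z i
            else if [pick k | v k == j] is Some k then z (s k) else false.
have -> : z = [ffun k : 'I_n.+1 => x k].
  by apply/ffunP => k; rewrite ffunE /x valK.
rewrite pull self_dualization_of_self_dual //; congr (f _).
apply/ffunP => k; rewrite !ffunE /= -/(v k); congr (_ (+) _).
rewrite /x valK; case: insubP => [i vk iE|_].
  by congr (z _); apply/val_inj; rewrite /= iE sE.
case: pickP => [l /eqP/v_inj -> //|/(_ k)]; by rewrite eqxx.
Qed.

Lemma same_sd_class_restrict n (f : bfun n.+1) i s (p : 'S_n) :
  self_dual f -> same_sd_class (perm_vars p (restrict f i s)) f.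
Proof.
move=> sdf; set g := perm_vars _ _.
(* [pi] makes the fixed variable [i] of [f] the variable 0 added by self-dualization; for [s = true]
   that variable must also be negated. *)
pose pi := lift_perm i ord0 p.
have sdg : same_sd_class g (self_dualization g) by do 2 constructor.
have gE x : self_dualization g x =
    f [ffun k => if k == i then x (pi k) (+) s else x (pi k)].
  rewrite -(binsertK ord0 x); set z := [ffun k => x _].
  have -> : [ffun k => if k == i then binsert ord0 (x ord0) z (pi k) (+) s
      else binsert ord0 (x ord0) z (pi k)] =
      binsert i (x ord0 (+) s) [ffun k => z (p k)].
    apply/ffunP => k; rewrite ffunE; case: (unliftP i k) => [l|] ->.
      rewrite eq_sym (negPf (neq_lift _ _)) lift_perm_lift !binsert_lift.
      by rewrite [RHS]ffunE.
    by rewrite eqxx lift_perm_id !binsert_id.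
  rewrite self_dualizationE !ffunE; case: (x ord0) => //=.
  rewrite -self_dualE // bcompl_binsert; congr (f (binsert _ _ _)).
  by apply/ffunP => k; rewrite !ffunE negbK.
case: s g sdg gE => g sdg gE.
  have -> : f = perm_vars pi^-1 (neg_var ord0 (self_dualization g)).
    apply/ffunP => x; do 2 rewrite [RHS]ffunE; rewrite gE.
    congr (f _); apply/ffunP => k; rewrite !ffunE.
    rewrite -(inj_eq (@perm_inj _ pi)) lift_perm_id permK.
    by case: eqP => //; rewrite addbT negbK.
  by do 2 constructor.
have -> : f = perm_vars pi^-1 (self_dualization g).
  apply/ffunP => x; rewrite ffunE gE; congr (f _); apply/ffunP => k.
  by rewrite !ffunE addbF if_same permK.
by constructor.
Qed.

(** * Realizations: positivity, smallness and ampleness *)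

Section Realizations.
Local Open Scope ring_scope.

Lemma dot_perm n (w : 'I_n -> rat) (p : 'S_n) (x : bvec n) :
  dot w [ffun i => x (p i)] = dot (w \o (p^-1)%g) x.
Proof.
rewrite /dot [RHS](reindex_inj (@perm_inj _ p)) /=.
by apply: eq_bigr => i _; rewrite ffunE permK.
Qed.

Lemma realization_perm n (g : bfun n) w theta (p : 'S_n) :
  realization g w theta -> realization (perm_vars p g) (w \o (p^-1)%g) theta.
Proof. by move=> gr x; rewrite ffunE gr dot_perm. Qed.

Lemma positive_perm n (g : bfun n) (p : 'S_n) :
  positive g -> positive (perm_vars p g).
Proof.
move=> [w [t [gr w0]]]; exists (w \o (p^-1)%g), t.
by split=> [|i]; [apply: realization_perm | apply: w0].
Qed.

Lemma small_perm n (g : bfun n) (p : 'S_n) :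
  small g -> small (perm_vars p g).
Proof.
move=> [w [t [gr wt]]]; exists (w \o (p^-1)%g), t.
by split=> [|i]; [apply: realization_perm | apply: wt].
Qed.

Lemma ample_perm n (g : bfun n) (p : 'S_n) :
  ample g -> ample (perm_vars p g).
Proof.
move=> [w [t [gr wt]]]; exists (w \o (p^-1)%g), t.
split; first exact: realization_perm.
by rewrite (reindex_inj (@perm_inj _ p)); under eq_bigr do rewrite /= permK.
Qed.

Lemma positive_mono n (g : bfun n) (x y : bvec n) :
  positive g -> (forall k, x k -> y k) -> g x -> g y.
Proof.
move=> [w [t [gr w0]]] xy; rewrite !gr /sgn !subr_gt0 => /lt_le_trans; apply.
apply: ler_sum => k _; apply: ler_wpM2l; first exact: ltW.
by have := xy k; case: (x k); case: (y k) => // /(_ isT).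
Qed.

Lemma dot_binsert n (w : 'I_n.+1 -> rat) i s (y : bvec n) :
  dot w (binsert i s y) = w i * s%:R + dot (w \o lift i) y.
Proof.
rewrite /dot (bigD1_ord i) //= binsert_id; congr (_ + _).
by apply: eq_bigr => k _; rewrite binsert_lift.
Qed.

Lemma realization_restrict n (f : bfun n.+1) w t i s :
  realization f w t ->
  realization (restrict f i s) (w \o lift i) (t - w i * s%:R).
Proof.
move=> fr y; rewrite ffunE fr dot_binsert; congr sgn.
by rewrite opprB addrA; congr (_ - _); rewrite addrC.
Qed.

Lemma positive_restrict n (f : bfun n.+1) i s :
  positive f -> positive (restrict f i s).
Proof.
move=> [w [t [fr w0]]]; exists (w \o lift i), (t - w i * s%:R).
by split; [apply: realization_restrict | move=> k; apply: w0].
Qed.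

Lemma dot_bcompl n (w : 'I_n -> rat) (x : bvec n) :
  dot w (bcompl x) = \sum_i w i - dot w x.
Proof.
rewrite /dot -sumrB; apply: eq_bigr => i _; rewrite ffunE.
by case: (x i); rewrite /= ?mulr1 ?mulr0 ?subrr ?subr0.
Qed.

(** With [S] the total weight, [x] and its complement have products [d] and [S - d], exactly one of
    which exceeds [t]. Hence [d > t >= S - d] or [d <= t < S - d], which compares [d] with
    [S / 2]. *)
Lemma self_dual_realization n (f : bfun n) w t : self_dual f ->
  realization f w t -> realization f w ((\sum_i w i) / 2).
Proof.
move=> sdf fr x; have := self_dualE x sdf.
rewrite !fr dot_bcompl /sgn; set S := \sum_i _; set d := dot _ _.
rewrite !subr_gt0.
case: (ltP t d) => td; case: (ltP t (S - d)) => tS //= _; apply/esym.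
  lra.
by apply/negbTE; rewrite -leNgt; lra.
Qed.

Lemma ample_restrict_true n (f : bfun n.+1) i :
  positive f -> self_dual f -> ample (restrict f i true).
Proof.
move=> [w [t [fr w0]]] sdf.
have := realization_restrict i true (self_dual_realization sdf fr).
(* Fixing [x_i = 1] lowers the total weight by [w i] but twice the threshold by [2 * w i], turning
   equality into strict inequality. *)
exists (w \o lift i), ((\sum_i w i) / 2 - w i * 1); split; first by [].
rewrite (bigD1_ord i) //=; have := w0 i; lra.
Qed.

End Realizations.

(** * Counting true points *)

Lemma card_false_set n (g : bfun n) : #|false_set g| = 2 ^ n - #|true_set g|.
Proof.
have -> : false_set g = ~: true_set g by apply/setP => x; rewrite !inE.
by rewrite cardsCs setCK card_ffun card_bool card_ord.
Qed.

Lemma card_true_set_le n (g : bfun n) : #|true_set g| <= 2 ^ n.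
Proof.
by rewrite -[X in _ <= X ^ _]card_bool -[X in _ <= _ ^ X]card_ord -card_ffun
  max_card.
Qed.

(** Complementation injects the false points into the true ones: if [dot w x <= t], the complement
    has product at least [S - t > t], with [S] the total weight. *)
Lemma ample_card n (g : bfun n) : ample g -> 2 ^ n <= 2 * #|true_set g|.
Proof.
move=> [w [t [gr wt]]].
have : #|false_set g| <= #|true_set g|.
  rewrite -(card_imset _ (inv_inj (@bcomplK n))); apply/subset_leq_card.
  apply/subsetP => _ /imsetP[x xF ->]; move: xF.
  by rewrite !inE !gr dot_bcompl /sgn -leNgt; lra.
by rewrite card_false_set leq_subLR addnn mul2n.
Qed.

Lemma card_true_set_perm n (g : bfun n) (p : 'S_n) :
  #|true_set (perm_vars p g)| = #|true_set g|.
Proof.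
pose u (q : 'S_n) (x : bvec n) : bvec n := [ffun i => x (q i)].
have u_inj q : injective (u q).
  move=> x y /ffunP E; apply/ffunP => i.
  by have := E (q^-1%g i); rewrite !ffunE permKV.
rewrite -(card_imset _ (u_inj p)); apply: eq_card => x.
have xE : x = u p (u p^-1%g x) by apply/ffunP => i; rewrite !ffunE permK.
by rewrite {1}xE mem_imset // !inE ffunE [X in g X](_ : _ = x).
Qed.

Lemma card_true_set_restrict n (f : bfun n.+1) i s :
  #|true_set (restrict f i s)| = #|[set x in true_set f | x i == s]|.
Proof.
have ins_inj : injective (@binsert n i s).
  move=> x y /ffunP E; apply/ffunP => k.
  by have := E (lift i k); rewrite !binsert_lift.
rewrite -(card_imset _ ins_inj); apply: eq_card => x; rewrite !inE.
apply/imsetP/andP => [[y]|[fx /eqP xi]].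
  by rewrite inE ffunE => fy ->; rewrite binsert_id.
exists [ffun k => x (lift i k)]; last by rewrite -xi binsertK.
by rewrite inE ffunE -xi binsertK.
Qed.

Lemma self_dual_card n (f : bfun n.+1) i : self_dual f ->
  #|true_set (restrict f i false)| = 2 ^ n - #|true_set (restrict f i true)|.
Proof.
move=> sdf; rewrite -card_false_set -(card_imset _ (inv_inj (@bcomplK n))).
apply: eq_card => x.
rewrite -[in LHS](bcomplK x) (mem_imset _ _ (inv_inj (@bcomplK n))).
by rewrite !inE (restrict_self_dual _ true).
Qed.

(** Complementation maps the true set onto the false set, so both sums in the Chow parameter are
    equal and the factor 2 cancels. *)
Lemma chow_self_dual n (f : bfun n.+1) m (a : {ffun 'I_n.+1 -> nat}) i :
  self_dual f -> chow f = (m, [ffun i => 2 * a i]) ->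
  #|true_set (restrict f i true)| = a i.
Proof.
move=> sdf [_ /ffunP/(_ i)]; rewrite !ffunE.
have -> : \sum_(x in false_set f) bcompl x i = \sum_(x in true_set f) x i.
  rewrite [RHS](reindex_inj (inv_inj (@bcomplK _))); apply: eq_bigl => x.
  by rewrite !inE self_dualE.
rewrite addnn -mul2n => /eqP; rewrite eqn_pmul2l // => /eqP <-.
rewrite card_true_set_restrict -sum1_card big_mkcond [RHS]big_mkcond /=.
by apply: eq_bigr => x _; rewrite !inE; case: (f x); case: (x i).
Qed.

Lemma restrict_false_sub n (f : bfun n.+1) i :
  positive f ->
  true_set (restrict f i false) \subset true_set (restrict f i true).
Proof.
move=> posf; apply/subsetP => x; rewrite !inE !ffunE.
apply: positive_mono => // k; case: (unliftP i k) => [l|] ->.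
  by rewrite !binsert_lift.
by rewrite !binsert_id.
Qed.

(** Monotonicity makes one true set a subset of the other; the cardinalities then force equality. *)
Lemma restrict_eq n (f : bfun n.+1) i : positive f ->
  #|true_set (restrict f i true)| <= #|true_set (restrict f i false)| ->
  restrict f i true = restrict f i false.
Proof.
move=> posf le_card.
have /eqP E : true_set (restrict f i false) == true_set (restrict f i true).
  by rewrite eqEcard restrict_false_sub.
by apply/ffunP => x; have /setP/(_ x) := E; rewrite !inE.
Qed.

(** * Symmetry in variables with equal counts *)

Definition bswap n (i j : 'I_n) (x : bvec n) : bvec n :=
  [ffun k => x (tperm i j k)].

Lemma bswapK n (i j : 'I_n) : involutive (bswap i j).
Proof. by move=> x; apply/ffunP => k; rewrite !ffunE tpermK. Qed.

(* Say [w j <= w i]. Moving a 1 from [j] to [i] then preserves truth, so it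
   injects the true points with (x_i, x_j) = (0, 1) into those with (1, 0); when
   the two counts agree this is a bijection. *)
Lemma ltf_swap n (f : bfun n.+1) i j : ltf f ->
  #|true_set (restrict f i true)| = #|true_set (restrict f j true)| ->
  forall x, f (bswap i j x) = f x.
Proof.
move=> [w [t fr]].
wlog wij : i j / (w j <= w i)%R => [IH E|].
  have [/IH|/ltW/IH] := leP (w j) (w i); first exact.
  by move=> + x; rewrite /bswap tpermC; apply.
have [-> _ x|ij] := eqVneq i j.
  by congr (f _); apply/ffunP => k; rewrite ffunE tperm1 perm1.
rewrite !card_true_set_restrict.
set Ti := [set x : bvec n.+1 in _ | x i == _]; set Tj := [set x in _ | _].
rewrite -(cardsID Tj Ti) -(cardsID Ti Tj) setIC => /addnI card_eq.
have sub_BA : bswap i j @: (Tj :\: Ti) \subset Ti :\: Tj.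
  apply/subsetP => _ /imsetP[x xB ->]; move: xB; rewrite !inE !ffunE.
  rewrite tpermL tpermR; case fx: (f x) => //=; case xi: (x i) => //=.
  case xj: (x j) => //= _; rewrite andbF andbT; move: fx.
  rewrite !fr /sgn !subr_gt0 dot_perm tpermV => /lt_le_trans; apply.
  apply: ler_sum => k _ /=; case: tpermP => [->|->|//].
    by rewrite xi !mulr0.
  by rewrite xj !mulr1.
have imBA : bswap i j @: (Tj :\: Ti) = Ti :\: Tj.
  apply/eqP; rewrite eqEcard sub_BA card_eq.
  by rewrite (card_imset _ (inv_inj (bswapK i j))) leqnn.
have swapA (x : bvec n.+1) : x i -> ~~ x j -> f (bswap i j x) = f x.
  move=> xi xj.
  have := mem_imset (Tj :\: Ti) (bswap i j x) (inv_inj (bswapK i j)).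
  rewrite bswapK imBA !inE !ffunE tpermL tpermR xi (negPf xj) /=.
  by rewrite andbT !andbF !andbT.
move=> x; case xi: (x i); case xj: (x j).
- congr (f _); apply/ffunP => k; rewrite ffunE.
  by case: tpermP => [->|->|]; rewrite ?xi ?xj.
- by rewrite swapA ?xi ?xj.
- by rewrite -[in RHS](bswapK i j x) (swapA (bswap i j x)) // ffunE ?tpermL ?tpermR ?xi ?xj.
- congr (f _); apply/ffunP => k; rewrite ffunE.
  by case: tpermP => [->|->|]; rewrite ?xi ?xj.
Qed.

(** The transposition of [i] and [j] sends [j] to [i], hence induces a permutation [p] of the
    remaining variables. *)
Lemma restrict_swap n (f : bfun n.+1) i j s : ltf f ->
  #|true_set (restrict f i true)| = #|true_set (restrict f j true)| ->
  exists p : 'S_n, restrict f i s = perm_vars p (restrict f j s).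
Proof.
move=> ltff /(ltf_swap ltff) swapf.
have [p pE] := lift_perm_ex (tpermR i j).
by exists p; apply/ffunP => y; rewrite !ffunE -swapf /bswap pE binsert_perm.
Qed.

(** * One index for each value of [a] *)

(** The least index carrying the value qualifies. *)
Lemma new_value_ex n (a : {ffun 'I_n.+1 -> nat}) i :
  exists2 j, new_value a j & a j = a i.
Proof.
have [j /eqP aji j_min] :=
  @arg_minnP 'I_n.+1 i [pred k | a k == a i] val (eqxx _).
exists j => //; rewrite /new_value -implyNb; apply/implyP => j0.
apply/eqP => aj; have := j_min (inord j.-1); rewrite /= -aj aji eqxx => /(_ isT).
have j_gt0 : 0 < j by rewrite lt0n.
rewrite inordK; last by rewrite (leq_ltn_trans (leq_pred j)).
by rewrite -ltnS prednK // ltnn.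
Qed.

(** By monotonicity equal values fill an interval of indices, so if [i < j] shared a value, [j - 1]
    would share it too. *)
Lemma new_value_inj n (a : {ffun 'I_n.+1 -> nat}) i j : monotonic a ->
  new_value a i -> new_value a j -> a i = a j -> i = j.
Proof.
move=> mono_a; wlog ij : i j / i <= j => [IH|].
  by case/orP: (leq_total i j) => /IH // /[swap] ni /[swap] nj /[swap] /esym aij
    /(_ nj ni aij).
move=> _ /orP[/eqP j0 _|/eqP aj aij].
  by apply/val_inj/eqP; rewrite /= eqn_leq ij /= j0.
apply/eqP; case: eqVneq => // neq_ij.
have lt_ij : i < j by rewrite ltn_neqAle ij andbT.
case: aj; have j_gt0 : 0 < j by apply: leq_trans lt_ij.
set k : 'I_n.+1 := inord _.
have kE : k = j.-1 :> nat by rewrite inordK // (leq_ltn_trans (leq_pred j)).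
have ik : i <= k by rewrite kE -ltnS prednK.
have kj : k <= j by rewrite kE leq_pred.
by apply/eqP; rewrite eqn_leq; case: mono_a => mono_a;
  rewrite (mono_a _ _ kj) -?aij ?(mono_a _ _ ik) ?andbT //= aij (mono_a _ _ kj).
Qed.

(** * Positive members of an SD class as restrictions *)

Lemma same_sd_class_restrictP n (g : bfun n) (f : bfun n.+1) :
  positive g -> positive f -> self_dual f -> same_sd_class g f ->
  exists i s (p : 'S_n), g = perm_vars p (restrict f i s).
Proof.
move=> posg posf sdf /(same_sd_class_perm_neg sdf)[q [c gE]].
(* [i] is the variable of [f] fed by the added variable 0; setting the latter to [false] sets [x_i]
   to [c i]. *)
pose i := (q^-1)%g ord0.
have [p pE] := lift_perm_ex (permKV q ord0); rewrite -/i in pE.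
pose h := restrict f i (c i); exists i, (c i), p; rewrite -/h.
have posh : positive h := positive_restrict i (c i) posf.
have ghE y : g y = h [ffun k => y (p k) (+) c (lift i k)].
  have := gE (binsert ord0 false y); rewrite self_dualizationE => ->.
  rewrite ffunE; congr (f _); apply/ffunP => k.
  rewrite ffunE pE; case: (unliftP i k) => [l|] ->.
    by rewrite lift_perm_lift !binsert_lift ffunE.
  by rewrite lift_perm_id !binsert_id.
pose d k := c (lift i k).
apply/ffunP => y; rewrite [RHS]ffunE; apply/idP/idP.
  (* Raising [y] to 1 at the negated variables keeps [g] true and puts 0 there in the argument of
     [h], which thus lies below the permuted [y]. The converse lowers [y] to 0 there instead. *)
  pose z : bvec n := [ffun k => y k || d (p^-1 k)%g].
  have yz : g y -> g z by apply: positive_mono => // k yk; rewrite ffunE yk.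
  move=> /yz; rewrite ghE; apply: positive_mono => // k; rewrite !ffunE permK -/(d k).
  by case: (d k); rewrite ?orbT ?orbF ?addbF.
pose z : bvec n := [ffun k => y k && ~~ d (p^-1 k)%g].
have zy : g z -> g y by apply: positive_mono => // k; rewrite ffunE => /andP[].
move=> hy; apply: zy; rewrite ghE; move: hy; apply: positive_mono => // k.
by rewrite !ffunE permK -/(d k); case: (d k); rewrite ?andbF ?andbT ?addbF ?addbT.
Qed.

(** * The count for a single generator *)

Section CanonicalGenerator.
Variables (n : nat) (f : bfun n.+1) (a : {ffun 'I_n.+1 -> nat}).
Hypotheses (n_gt0 : 0 < n) (fa : canonical_generator f a).

Let half : 2 ^ n = 2 * 2 ^ n.-1.
Proof. by rewrite -expnS prednK. Qed.

Lemma generator_card i s :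
  #|true_set (restrict f i s)| = if s then a i else 2 ^ n - a i.
Proof.
have [_ sdf chowf _] := fa; have aE := chow_self_dual i sdf chowf.
by case: s => //; rewrite self_dual_card // aE.
Qed.

Lemma generator_ge i : 2 ^ n.-1 <= a i.
Proof.
have [posf sdf _ _] := fa.
have := ample_card (ample_restrict_true i posf sdf).
by rewrite generator_card half leq_pmul2l.
Qed.

Lemma generator_restrict_eq i s t :
  a i = 2 ^ n.-1 -> restrict f i s = restrict f i t.
Proof.
move=> ai; have [posf _ _ _] := fa.
have E : restrict f i true = restrict f i false.
  by apply: restrict_eq => //; rewrite !generator_card ai half mul2n -addnn addnK.
by case: s; case: t.
Qed.

Lemma generator_cover (g : bfun n) : positive g -> same_sd_class g f ->
  exists i s (p : 'S_n), new_value a i /\ g = perm_vars p (restrict f i s).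
Proof.
move=> posg gf; have [posf sdf _ _] := fa.
have [i [s [p ->]]] := same_sd_class_restrictP posg posf sdf gf.
have [j nj aji] := new_value_ex a i.
have ltff : ltf f by have [w [t [? _]]] := posf; exists w, t.
have [q ->] : exists q : 'S_n, restrict f i s = perm_vars q (restrict f j s).
  by apply: restrict_swap; rewrite // !generator_card.
by exists j, s, (q * p)%g; rewrite perm_varsM.
Qed.

Lemma generator_disjoint i j s t (p q : 'S_n) :
  new_value a i -> new_value a j ->
  perm_vars p (restrict f i s) = perm_vars q (restrict f j t) ->
  i = j /\ (s = t \/ a i = 2 ^ n.-1).
Proof.
move=> ni nj /(congr1 (fun g => #|true_set g|)).
rewrite !card_true_set_perm !generator_card; have [_ _ _ mono_a] := fa.
(* This bound makes the truncated subtraction [2 ^ n - a k] injective in [a k]. *)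
have le_a k : a k <= 2 ^ n.
  by rewrite -(generator_card k true) card_true_set_le.
have [[ge_i ge_j] [le_i le_j]] :=
  ((generator_ge i, generator_ge j), (le_a i, le_a j)).
move=> card_eq; have half_n := half.
have [/(new_value_inj mono_a ni nj) ij|neq_a] := eqVneq (a i) (a j).
  by split=> //; rewrite -ij in card_eq; case: s t card_eq => [] []; auto;
    right; lia.
by case: s t card_eq => [] []; lia.
Qed.

(** Common form of both counts: [sel] says which restrictions are tested at [i], [Q] is the extra
    property demanded. The hypotheses ensure in turn that coinciding restrictions are counted once,
    that only functions with [Q] are counted, and that none is missed. *)
Lemma generator_sum (sel : 'I_n.+1 -> bool -> bool) (Q : bfun n -> Prop) :
  (forall i s t, a i = 2 ^ n.-1 -> sel i s -> sel i t -> s = t) ->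
  (forall i s (p : 'S_n), sel i s -> Q (perm_vars p (restrict f i s))) ->
  (forall i s (p : 'S_n), Q (perm_vars p (restrict f i s)) ->
     exists2 t, sel i t & restrict f i t = restrict f i s) ->
  \sum_(i | new_value a i) \sum_(s | sel i s && `[< small (restrict f i s) >])
     PermCount f i s =
  #|[set g : bfun n | `[< [/\ positive g, small g, Q g & same_sd_class g f] >]]|.
Proof.
move=> sel_uniq selQ Qsel; have [posf sdf _ _] := fa.
rewrite pair_big_dep; apply: card_unique_cover => [[i s] /=|g].
  case/and3P=> _ sel_s /asboolP smallf; apply/subsetP => _ /imsetP[p _ ->].
  rewrite inE; apply/asboolP; split; [|exact: small_perm|exact: selQ|].
    exact/positive_perm/positive_restrict.
  exact: same_sd_class_restrict.
rewrite inE => /asboolP[posg smallg Qg gf].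
have [i [s [p [ni gE]]]] := generator_cover posg gf.
have [t sel_t tE] : exists2 t, sel i t & restrict f i t = restrict f i s.
  by apply: (Qsel _ _ p); rewrite -gE.
exists (i, t); split; [split=> /=|].
- rewrite ni sel_t tE /=; apply/asboolP; rewrite -[restrict _ _ _](perm_varsK p) -gE.
  exact: small_perm.
- by rewrite gE -tE; apply/imsetP; exists p.
- case=> j u /= [/and3P[nj sel_u _] /imsetP[q _ gE']].
  have [|ij tu] := @generator_disjoint i j t u p q ni nj _.
    by rewrite tE -gE.
  rewrite -ij in sel_u *; congr (_, _).
  by case: tu => // ai; apply: sel_uniq ai _ _.
Qed.

Lemma SGoldSD_card :
  SGoldSD f a =
  #|[set g : bfun n | `[< [/\ positive g, small g, True & same_sd_class g f] >]]|.
Proof.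
rewrite -(@generator_sum (fun i s => s || (a i != 2 ^ n.-1))) //.
- by apply: eq_bigr => i _; rewrite big_mkcond big_bool /= andbC.
- by move=> i s t ->; rewrite eqxx !orbF => -> ->.
- move=> i s p _; case: (eqVneq (a i) (2 ^ n.-1)) => [ai|_].
    by exists true => //; apply: generator_restrict_eq.
  by exists s; rewrite ?orbT.
Qed.

Lemma GoldSD_card :
  GoldSD f a =
  #|[set g : bfun n | `[< [/\ positive g, small g, ample g & same_sd_class g f] >]]|.
Proof.
have [posf sdf _ _] := fa.
rewrite -(@generator_sum (fun i s => s == (2 ^ n.-1 < a i))).
- apply: eq_bigr => i _; rewrite big_mkcond big_bool /=.
  by case: (_ < _); rewrite /= ?addn0.
- by move=> i s t _ /eqP-> /eqP->.
(* The value [false] is selected only when [a i = 2 ^ n.-1], where both restrictions coincide and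
   the one at [true] is ample. *)
- move=> i s p /eqP->; apply: ample_perm; case: ltnP => ai.
    exact: ample_restrict_true.
  rewrite (@generator_restrict_eq _ _ true); first exact: ample_restrict_true.
  by apply/eqP; rewrite eqn_leq ai generator_ge.
(* If [a i > 2 ^ n.-1], the restriction at [false] has fewer than [2 ^ n.-1] true points and cannot
   be ample. *)
- move=> i s p /ample_card; rewrite card_true_set_perm generator_card => le_s.
  have := generator_ge i; rewrite leq_eqVlt => /orP[/eqP/esym ai | lt_ai].
    by eexists; [apply: eqxx | apply: generator_restrict_eq].
  exists s => //; rewrite lt_ai; case: s le_s => //; move: half lt_ai; lia.
Qed.

End CanonicalGenerator.

(** * Summation over all generators *)

(** A positive function is a threshold function, so its SD class contains exactly one generator; the
    sets [F f] therefore partition the functions satisfying [P]. *)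
Lemma generators_sum n (G : {set bfun n.+1}) a (P : bfun n -> Prop)
    (F : bfun n.+1 -> {set bfun n}) : canonical_generators G a ->
  (forall g, P g -> positive g) ->
  (forall f, f \in G -> F f = [set g | `[< P g /\ same_sd_class g f >]]) ->
  \sum_(f in G) #|F f| = #|[set g : bfun n | `[< P g >]]|.
Proof.
move=> [_ _ uniqG] Ppos FE; apply: card_unique_cover => [f fG|g].
  rewrite FE //; apply/subsetP => g; rewrite !inE => /asboolP[Pg _].
  exact/asboolP.
rewrite inE => /asboolP Pg.
have [|f [[fG gf] f_uniq]] := uniqG g.
  by have [w [t [? _]]] := Ppos g Pg; exists w, t.
exists f; split=> [|f' [f'G]]; first by split=> //; rewrite FE // inE; apply/asboolP.
by rewrite FE // inE => /asboolP[_ gf']; apply: f_uniq.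
Qed.

Theorem theoremA2 (n : nat) (hn : 1 <= n) (G : {set bfun n.+1})
    (a : bfun n.+1 -> {ffun 'I_n.+1 -> nat})
    (hG : canonical_generators G a) :
  (\sum_(f in G) SGoldSD f (a f) =
     #|[set g : bfun n | `[< semi_goldilocks g >]]|) /\
  (\sum_(f in G) GoldSD f (a f) =
     #|[set g : bfun n | `[< goldilocks g >]]|).
Proof.
have [genG _ _] := hG; split.
- under eq_bigr => f fG do rewrite (SGoldSD_card hn (genG f fG)).
  apply: (generators_sum hG) => [g [] //|f _].
  apply/setP => g; rewrite !inE; apply/asboolP/asboolP.
    by case=> posg smallg _ gf.
  by case=> [[posg smallg] gf].
- under eq_bigr => f fG do rewrite (GoldSD_card hn (genG f fG)).
  apply: (generators_sum hG) => [g [] //|f _].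
  apply/setP => g; rewrite !inE; apply/asboolP/asboolP.
    by case=> posg smallg ampleg gf.
  by case=> [[posg smallg ampleg] gf].
Qed.
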